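(* Let $g(w)=\tfrac12 w^2e^{-w}\mathbf{1}\{w>0\}$ for $w\in\mathbb{R}$. For $\theta\in\mathbb{R}$ let $P_\theta$ be the probability measure on $\mathbb{R}\times\{-1,+1\}$ with density $$f_\theta(y,z)=\mathbf{1}\{z=+1\}\,g(y-\theta)+\mathbf{1}\{z=-1\}\,g(\theta-y)$$ with respect to $\mathfrak{m}\otimes\nu$, where $\mathfrak{m}$ is Lebesgue measure on $\mathbb{R}$ and $\nu$ is the probability measure putting mass $1/2$ at each of $+1$ and $-1$. Let $Q_\theta$ be the distribution of $y$ under $P_\theta$, that is, the probability measure on $\mathbb{R}$ with Lebesgue density $\tfrac12 g(y-\theta)+\tfrac12 g(\theta-y)$. For $n\ge1$ let $\mathcal{P}_n=\{P_\theta^{n}:\theta\in\mathbb{R}\}$ and $\mathcal{Q}_n=\{Q_\theta^{n}:\theta\in\mathbb{R}\}$ be the experiments of $n$-fold product measures. Then $\mathcal{P}_n$ and $\mathcal{Q}_n$ are asymptotically equivalent in Le Cam's sense: the Le Cam deficiency distance between $\mathcal{P}_n$ and $\mathcal{Q}_n$ (with the full parameter set $\mathbb{R}$) tends to $0$ as $n\to\infty$.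
   Context: For two experiments $\mathcal{E}=\{E_\theta:\theta\in\Theta\}$ and $\mathcal{F}=\{F_\theta:\theta\in\Theta\}$ (families of probability measures on possibly different measurable spaces, indexed by the same set $\Theta$), the deficiency of $\mathcal{E}$ with respect to $\mathcal{F}$ is $$\delta(\mathcal{E},\mathcal{F})=\inf_{T}\ \sup_{\theta\in\Theta}\ \|TE_\theta-F_\theta\|_{TV},$$ where the infimum is over all transitions $T$ (Le Cam's generalization of Markov kernels: positive linear maps, from the L-space of $\mathcal{E}$ to that of $\mathcal{F}$ or to a space of finite signed measures containing it, that preserve total mass of nonnegative elements; every Markov kernel, in particular every measurable map acting by taking image measures, defines a transition) and $\|\cdot\|_{TV}$ is the total variation norm (the choice of normalizing constant is immaterial). The Le Cam deficiency distance is $\max\{\delta(\mathcal{E},\mathcal{F}),\delta(\mathcal{F},\mathcal{E})\}$. *)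

(* Defs.v *)
From HB Require Import structures.
From mathcomp Require Import all_boot all_order all_algebra.
From mathcomp Require Import interval_inference.
From mathcomp Require Import all_classical all_reals all_analysis.
From mathcomp Require Import measurable_realfun ring lra.

Set Implicit Arguments.
Unset Strict Implicit.
Unset Printing Implicit Defensive.

Import Order.TTheory GRing.Theory Num.Theory.
Import numFieldNormedType.Exports.

Local Open Scope classical_set_scope.
Local Open Scope ring_scope.

Definition charge_of_prob d (X : measurableType d) (R : realType)
    (P : probability X R) : {charge set X -> \bar R} :=
  charge_of_finite_measure P.

(* nu^+(X) + nu^-(X) for a Hahn decomposition of nu; [tv_normE] below shows that
   the decomposition picked does not matter. *)
Definition tv_norm d (X : measurableType d) (R : realType)
    (nu : {charge set X -> \bar R}) : \bar R :=
  charge_variation (projT2 (cid (projT2 (cid (Hahn_decomposition nu))))) setT.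

Lemma tv_normE d (X : measurableType d) (R : realType)
    (nu : {charge set X -> \bar R}) (A B : set X)
    (nuAB : hahn_decomposition nu A B) :
  tv_norm nu = charge_variation nuAB setT.
Proof.
rewrite /tv_norm; set h := (X in charge_variation X).
have [e1 e2] := Hahn_decomposition_uniq h nuAB measurableT.
rewrite /charge_variation/= !jordan_posE !jordan_negE !cjordan_posE !cjordan_negE.
by rewrite /crestr0 mem_set// /crestr e1 e2.
Qed.

(* The L-space (band) of an experiment E: the finite signed measures dominated
   by some convergent sum \sum_i c_i E_(t_i) with c_i >= 0.  E need not be
   dominated by one of its members, so countable sums are required. *)
Definition Lspace d (X : measurableType d) (R : realType) (Theta : Type)
    (E : Theta -> probability X R) : set ({charge set X -> \bar R}) :=
  [set mu | exists (t : nat -> Theta) (c : nat -> {nonneg R}),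
      (\sum_(i <oo) (c i)%:num%:E < +oo)%E /\
      mu `<< mseries (fun i => mscale (c i) (E (t i))) 0].

(* Transitions from the L-space of E to the finite signed measures on Y.  The
   target is the largest one allowed: a transition into a space of finite signed
   measures on Y is also one into the space of all of them.  K is a total
   function, only its values on the L-space of E matter.  Elements of
   {charge set _ -> _} are compared on measurable sets only, their values on
   other sets being meaningless; positivity, linearity and mass preservation
   entail that K respects this comparison. *)
Definition transition dX dY (X : measurableType dX) (Y : measurableType dY)
    (R : realType) (Theta : Type) (E : Theta -> probability X R)
    (K : {charge set X -> \bar R} -> {charge set Y -> \bar R}) : Prop :=
  [/\ forall (a : R) (mu nu : {charge set X -> \bar R}),
        Lspace E mu -> Lspace E nu ->
        forall B, measurable B ->
          K (cadd (cscale a mu) nu) B = (a%:E * K mu B + K nu B)%E,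
      forall mu : {charge set X -> \bar R}, Lspace E mu ->
        (forall A, measurable A -> 0 <= mu A)%E ->
        (forall B, measurable B -> 0 <= K mu B)%E
    & forall mu : {charge set X -> \bar R}, Lspace E mu ->
        (forall A, measurable A -> 0 <= mu A)%E ->
        K mu setT = mu setT ].

Definition deficiency dX dY (X : measurableType dX) (Y : measurableType dY)
    (R : realType) (Theta : Type)
    (E : Theta -> probability X R) (F : Theta -> probability Y R) : \bar R :=
  ereal_inf [set ereal_sup
    [set tv_norm (cadd (K (charge_of_prob (E theta)))
                       (cscale (-1) (charge_of_prob (F theta))))
      | theta in [set: Theta]]
    | K in transition E].

Definition LeCam_distance dX dY (X : measurableType dX) (Y : measurableType dY)
    (R : realType) (Theta : Type)
    (E : Theta -> probability X R) (F : Theta -> probability Y R) : \bar R :=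
  maxe (deficiency E F) (deficiency F E).

Section tuple_cons.
Context d (X : measurableType d) (n : nat).

Definition tuple_cons (x : X * n.-tuple X) : n.+1.-tuple X :=
  [the n.+1.-tuple X of x.1 :: x.2].

Lemma measurable_tuple_cons : measurable_fun setT tuple_cons.
Proof. exact: measurable_cons. Qed.

HB.instance Definition _ :=
  isMeasurableFun.Build _ _ _ _ tuple_cons measurable_tuple_cons.

End tuple_cons.

Fixpoint prod_prob d (X : measurableType d) (R : realType)
    (P : probability X R) (n : nat) : probability (n.-tuple X) R :=
  match n with
  | 0%N => dirac ([tuple] : 0.-tuple X)
  | m.+1 => distribution (P \x prod_prob P m)%E (@tuple_cons _ X m)
  end.

Lemma prod_probE d (X : measurableType d) (R : realType)
    (P : probability X R) (n : nat) (A : 'I_n -> set X) :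
  (forall i, measurable (A i)) ->
  prod_prob P n [set x | forall i, A i (tnth x i)] = (\prod_(i < n) P (A i))%E.
Proof.
elim: n A => [|n IH] A mA.
  by rewrite big_ord0 /= diracE mem_set// => -[].
rewrite big_ord_recl -IH// -product_measure1E//; last first.
  rewrite (_ : mkset _ = \bigcap_(i in [set: 'I_n])
      ((@tnth _ X ^~ i) @^-1` A (lift ord0 i))); last first.
    by apply/seteqP; split => x /= h i; [move=> _|]; exact: h.
  apply: fin_bigcap_measurable => // i _.
  by rewrite -[X in measurable X]setTI; exact: measurable_tnth.
congr ((P \x prod_prob P n)%E _).
apply/seteqP; split => -[x s] /= h.
  split; first exact: (h ord0).
  by move=> i; have := h (lift ord0 i); rewrite tnthS.
move=> i; case: (unliftP ord0 i) => [j ->|->]; last by case: h.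
by rewrite tnthS; case: h.
Qed.

Definition gdens {R : realType} (w : R) : R :=
  if 0 < w then 2^-1 * w ^+ 2 * expR (- w) else 0.

(* z = +1 is encoded by true and z = -1 by false. *)
Definition fdens {R : realType} (theta : R) (yz : R * bool) : R :=
  if yz.2 then gdens (yz.1 - theta) else gdens (theta - yz.1).

Section densities.
Context {R : realType}.
Implicit Types (theta w : R).

Lemma gdens_ge0 w : 0 <= gdens w.
Proof.
rewrite /gdens; case: ifPn => // _; apply: mulr_ge0; last exact: expR_ge0.
by apply: mulr_ge0; rewrite ?invr_ge0 ?sqr_ge0.
Qed.

Let gdensE : @gdens R = fun w => 2^-1 * (Num.max 0 w * Num.max 0 w) * expR (- w).
Proof.
apply/funext => w; rewrite /gdens; case: ltP => // w0.
by rewrite !(mulr0, mul0r).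
Qed.

Lemma continuous_gdens : continuous (@gdens R).
Proof.
rewrite gdensE => w.
have cm : {for w, continuous (fun x : R => Num.max 0 x)}.
  by apply: (@continuous_max _ _ (cst 0) id); [exact: cvg_cst|exact: cvg_id].
apply: (@cvgM _ R); last first.
  by apply: continuous_comp; [by apply: (@continuousN _ R^o); exact: cvg_id|exact: continuous_expR].
apply: (@cvgM _ R); first exact: cvg_cst.
exact: (@cvgM _ R).
Qed.

Lemma measurable_gdens : measurable_fun setT (@gdens R).
Proof. apply: continuous_measurable_fun; exact: continuous_gdens. Qed.

Let F (w : R) := - (2^-1 * w ^+ 2 + w + 1) * expR (- w).

Let cvg_F : F x @[x --> +oo] --> (0 : R).
Proof.
apply/cvgrPdist_le => e e0; near=> x.
have x1 : 1 <= x by near: x; apply: nbhs_pinfty_ge; exact: num_real.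
have xe : 18 / e <= x by near: x; apply: nbhs_pinfty_ge; exact: num_real.
have x0 : 0 < x by lra.
rewrite sub0r /F mulNr opprK ger0_norm; last first.
  by rewrite mulr_ge0 ?expR_ge0// !addr_ge0// ?mulr_ge0 ?sqr_ge0// ltW.
have := @expR_ge1Dxn R x 2 (ltW x0).
rewrite expRN; set E := expR x => hE.
have E0 : 0 < E by exact: expR_gt0.
rewrite ler_pdivrMr//.
have h6 : x ^+ 3 / 6 <= E by apply: le_trans hE; rewrite lerDr.
have : e * (x ^+ 3 / 6) <= e * E by rewrite ler_pM2l.
apply: le_trans.
have : 18 <= x * e by rewrite -ler_pdivrMr.
have : x * x * 18 <= x * x * (x * e).
  by rewrite ler_pM2l ?mulr_gt0// -ler_pdivrMr.
have : x <= x * x by rewrite ler_peMr// ltW.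
rewrite !exprS expr0 mulr1; nra.
Unshelve. all: end_near. Qed.

Let dF (x : R) : is_derive x 1 F (2^-1 * x ^+ 2 * expR (- x)).
Proof.
apply: is_derive_eq.
by rewrite /GRing.scale /=; field.
Qed.

Lemma integral_gdens : (\int[lebesgue_measure]_w (gdens w : R)%:E = 1)%E.
Proof.
rewrite -(setUv `[0, +oo[%classic) ge0_integral_setU//=; last 4 first.
- exact: measurableC.
- rewrite setUv; apply/measurable_EFinP; exact: measurable_gdens.
- by move=> x _; rewrite lee_fin gdens_ge0.
- exact/disj_setPCl.
rewrite [X in (_ + X)%E]integral0_eq ?adde0; last first.
  move=> x /= x0; rewrite /gdens ifF//; apply/negbTE; rewrite -leNgt.
  by move/negP: x0; rewrite in_itv/= andbT -ltNge => /ltW.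
rewrite (@ge0_continuous_FTC2y _ _ F _ 0)//.
- by rewrite -EFinB /F oppr0 expR0; congr EFin; ring.
- by move=> x _; exact: gdens_ge0.
- exact: continuous_subspaceT continuous_gdens.
- apply: cvg_at_right_filter; apply: differentiable_continuous.
  by apply/derivable1_diffP; case: (dF 0).
- move=> x; rewrite in_itv/= andbT => x0.
  by case: (dF x) => _ dFx; rewrite derive1E dFx /gdens x0.
Qed.

Lemma integral_shift theta (h : R -> R) : continuous h -> (forall x, 0 <= h x) ->
  (\int[lebesgue_measure]_y (h (y - theta))%:E =
   \int[lebesgue_measure]_y (h y)%:E)%E.
Proof.
move=> ch h0.
pose S (y : R) := y - theta.
have dS (y : R) : is_derive y 1 S 1.
  by apply: is_derive_eq; rewrite subr0.
have S'E : (S^`())%classic = cst 1 by apply/funext => y; rewrite derive1E derive_val.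
rewrite [RHS](@increasing_ge0_integration_by_substitutionT _ S)//.
- by apply: eq_integral => y _; rewrite S'E/= fctE/= mulr1.
- by move=> x y xy; rewrite /S ltrD2r.
- by rewrite S'E; move=> ?; exact: cvg_cst.
- by rewrite S'E; exact: is_cvg_cst.
- by rewrite S'E; exact: is_cvg_cst.
- exact: cvg_addrr_Ny.
- exact: cvg_addrr.
Qed.

Lemma integral_oppr (h : R -> R) : measurable_fun setT h -> (forall x, 0 <= h x) ->
  (\int[lebesgue_measure]_y (h (- y))%:E =
   \int[lebesgue_measure]_y (h y)%:E)%E.
Proof.
move=> mh h0.
transitivity (\int[pushforward lebesgue_measure (-%R : _ -> measurableTypeR R)]_y
    (h y)%:E)%E.
  rewrite ge0_integral_pushforward//=.
  - exact/measurable_EFinP.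
  - by move=> y _; rewrite lee_fin.
by apply: eq_measure_integral => //= A mA _; exact: lebesgue_measureN.
Qed.

Lemma integral_gdens_shift theta :
  (\int[lebesgue_measure]_y (gdens (y - theta) : R)%:E = 1)%E.
Proof.
by rewrite integral_shift ?integral_gdens//; [exact: continuous_gdens|exact: gdens_ge0].
Qed.

Lemma integral_gdens_flip theta :
  (\int[lebesgue_measure]_y (gdens (theta - y) : R)%:E = 1)%E.
Proof.
under eq_integral do rewrite -opprB.
rewrite (@integral_shift theta (gdens \o -%R))/=.
- by rewrite integral_oppr ?integral_gdens//; [exact: measurable_gdens|exact: gdens_ge0].
- move=> x; apply: continuous_comp; last exact: continuous_gdens.
  by apply: (@continuousN _ R^o); exact: cvg_id.
- by move=> x; exact: gdens_ge0.
Qed.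

Lemma fdens_ge0 theta yz : 0 <= fdens theta yz.
Proof. by rewrite /fdens; case: ifPn => _; exact: gdens_ge0. Qed.

Lemma measurable_fdens theta : measurable_fun setT (fdens theta).
Proof.
apply: measurable_fun_ifT => //=.
- apply: measurableT_comp; first exact: measurable_gdens.
  exact: measurable_funB.
- apply: measurableT_comp; first exact: measurable_gdens.
  exact: measurable_funB.
Qed.

(* bernoulli_prob 2^-1 is the uniform probability on the two signs. *)
Definition Pmeas theta (A : set (R * bool)) : \bar R :=
  (\int[lebesgue_measure \x bernoulli_prob (2^-1 : R)]_(yz in A) (fdens theta yz)%:E)%E.

Let P0 theta : Pmeas theta set0 = 0%E.
Proof. by rewrite /Pmeas integral_set0. Qed.

Let P_ge0 theta A : (0 <= Pmeas theta A)%E.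
Proof. by apply: integral_ge0 => x _; rewrite lee_fin fdens_ge0. Qed.

Let P_sigma_additive theta : semi_sigma_additive (Pmeas theta).
Proof.
move=> /= B mB tB mUB; rewrite /Pmeas; apply: cvg_toP.
  apply: ereal_nondecreasing_is_cvgn => m n mn.
  apply: lee_sum_nneg_natr => // k _ _; exact: P_ge0.
rewrite ge0_integral_bigcup//=.
- by apply/measurable_funTS/measurable_EFinP; exact: measurable_fdens.
- by move=> x _; rewrite lee_fin fdens_ge0.
Qed.

HB.instance Definition _ theta := isMeasure.Build _ _ _ (Pmeas theta)
  (P0 theta) (@P_ge0 theta) (@P_sigma_additive theta).

Lemma Pmeas_setX theta (B : set R) : measurable B ->
  Pmeas theta (B `*` setT) =
    (\int[lebesgue_measure]_(y in B)
      (2^-1 * gdens (y - theta) + 2^-1 * gdens (theta - y))%:E)%E.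
Proof.
move=> mB; rewrite /Pmeas integral_mkcond/= fubini_tonelli1//=; last 2 first.
- apply/(measurable_restrictT _ _).1 => //.
    exact: measurableX.
  by apply/measurable_funTS/measurable_EFinP; exact: measurable_fdens.
- by move=> x; apply: erestrict_ge0 => y _; rewrite lee_fin fdens_ge0.
rewrite [RHS]integral_mkcond/=; apply: eq_integral => y _.
rewrite /fubini_F integral_bernoulli_prob; last 2 first.
- lra.
- by move=> x; apply: erestrict_ge0 => z _; rewrite lee_fin fdens_ge0.
rewrite !patchE; have [yB|yB] := boolP (y \in B).
  rewrite !mem_set//=; try by split => //; exact/set_mem.
  by rewrite -!EFinM -EFinD /fdens/= /unstable.onem; congr (_ + _ * _)%:E; lra.
have nB z : ((y, z) \in B `*` [set: bool]) = false.
  by apply: memNset => -[/mem_set/=]; rewrite (negbTE yB).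
rewrite !nB.
by rewrite /point/= !mule0 adde0.
Qed.

Let P_setT theta : Pmeas theta setT = 1%E.
Proof.
rewrite -setXTT Pmeas_setX//.
under eq_integral do rewrite EFinD !EFinM.
rewrite ge0_integralD//=.
- rewrite !ge0_integralZl//=.
  + by rewrite integral_gdens_shift integral_gdens_flip !mule1 -EFinD; congr EFin; lra.
  + apply/measurable_EFinP; apply: measurableT_comp; first exact: measurable_gdens.
    exact: measurable_funB.
  + by move=> x _; rewrite lee_fin gdens_ge0.
  + apply/measurable_EFinP; apply: measurableT_comp; first exact: measurable_gdens.
    exact: measurable_funB.
  + by move=> x _; rewrite lee_fin gdens_ge0.
- by move=> x _; rewrite mule_ge0// lee_fin ?gdens_ge0.
- apply/measurable_EFinP; apply: measurable_funM => //.
  apply: measurableT_comp; first exact: measurable_gdens.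
  exact: measurable_funB.
- by move=> x _; rewrite mule_ge0// lee_fin ?gdens_ge0.
- apply/measurable_EFinP; apply: measurable_funM => //.
  apply: measurableT_comp; first exact: measurable_gdens.
  exact: measurable_funB.
Qed.

HB.instance Definition _ theta := Measure_isProbability.Build _ _ _ (Pmeas theta)
  (P_setT theta).

HB.instance Definition _ :=
  isMeasurableFun.Build _ _ _ _ (@fst R bool) measurable_fst.

Definition Qmeas theta : set R -> \bar R := distribution (Pmeas theta) (@fst R bool).

HB.instance Definition _ theta := Probability.on (Qmeas theta).

Lemma QmeasE theta (B : set R) : measurable B ->
  Qmeas theta B =
    (\int[lebesgue_measure]_(y in B)
      (2^-1 * gdens (y - theta) + 2^-1 * gdens (theta - y))%:E)%E.
Proof.
move=> mB; rewrite -Pmeas_setX// /Qmeas /distribution /pushforward; congr Pmeas.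
by apply/seteqP; split => -[y z] //= [].
Qed.

End densities.

Definition Pn {R : realType} (n : nat) (theta : R) :
    probability (n.-tuple (R * bool)) R :=
  prod_prob (Pmeas theta) n.

Definition Qn {R : realType} (n : nat) (theta : R) :
    probability (n.-tuple R) R :=
  prod_prob (Qmeas theta) n.

(* Main.v *)
Require Import Defs.
From HB Require Import structures.
From mathcomp Require Import all_boot all_order all_algebra.
From mathcomp Require Import all_classical all_reals all_analysis.
From mathcomp Require Import measurable_realfun ring lra.

(** Q_theta^n is the image of P_theta^n under the projection of every pair
    (y, z) to y, so one of the two deficiencies is 0.  For the other one, the
    signs have to be recovered from the y_i alone.  Under P_theta, z is almost
    surely the sign of y - theta, so only theta is missing.

    The sample mean is a good enough substitute: relabel maps (y_i)_i to (y_i,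
    mean y < y_i)_i. Since y - theta is symmetric with variance 12, Chebyshev's
    inequality bounds the probability that the mean is delta or more away from
    theta by 12 / (n delta^2). The density of y is at most (y - theta)^2 / 2,
    it vanishes quadratically at theta, so the probability that some y_i lies
    within delta of theta is at most n delta^3. Off these two events the mean
    and theta are on the same side of every y_i, and relabel recovers the
    signs: mapped by relabel, Q_theta^n is within n delta^3 + 12 / (n delta^2)
    of P_theta^n on every event, uniformly in theta (Pn_relabel_le). A
    measurable map is a transition, hence the Le Cam distance is at most twice
    this bound (deficiency_le_map, LeCam_distance_le). The choice delta =
    n^(-2/5) makes both terms of order n^(-1/5).

    The variance of the sum comes from integrating one coordinate at a time
    (integral_prod_prob_sqr_sum): adding a centred variable of variance s to a
    constant c adds s to the mean of the square. *)

Set Implicit Arguments.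
Unset Strict Implicit.
Unset Printing Implicit Defensive.

Import Order.TTheory GRing.Theory Num.Theory.
Import numFieldNormedType.Exports.

Local Open Scope classical_set_scope.
Local Open Scope ring_scope.

(** * Deficiency along a measurable map *)

Section deficiency_bounds.
Local Open Scope ereal_scope.

(** The total variation is nu(P) - nu(N) for a Hahn decomposition (P, N). *)
Lemma tv_norm_le d (X : measurableType d) (R : realType)
    (nu : {charge set X -> \bar R}) (e : R) :
  (forall A, measurable A -> `|nu A| <= e%:E) -> tv_norm nu <= (2 * e)%:E.
Proof.
move=> nue; have [P [N nuPN]] := Hahn_decomposition nu.
have [[mP _] [mN _] _ _] := nuPN.
rewrite (tv_normE nuPN) /charge_variation /= jordan_posE jordan_negE.
rewrite cjordan_posE cjordan_negE.
rewrite /crestr0 mem_set// /crestr !setTI mulr_natl mulr2n EFinD leeD//.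
  exact: le_trans (lee_abs _) (nue _ mP).
by apply: le_trans (lee_abs _) _; rewrite abseN; exact: nue.
Qed.

Lemma tv_norm_ge0 d (X : measurableType d) (R : realType)
    (nu : {charge set X -> \bar R}) : 0 <= tv_norm nu.
Proof. by rewrite /tv_norm /charge_variation/= adde_ge0. Qed.

Lemma deficiency_ge0 dX dY (X : measurableType dX) (Y : measurableType dY)
    (R : realType) (Theta : Type) (theta0 : Theta)
    (E : Theta -> probability X R) (F : Theta -> probability Y R) :
  0 <= deficiency E F.
Proof.
apply: le_ereal_inf_tmp => _ [K _ <-].
apply: (le_trans (tv_norm_ge0 _)); apply: ereal_sup_ubound.
by exists theta0.
Qed.

(** Taking image measures by f is a transition; the factor 2 is that of
    tv_norm_le. *)
Lemma deficiency_le_map dX dY (X : measurableType dX) (Y : measurableType dY)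
    (R : realType) (Theta : Type)
    (E : Theta -> probability X R) (F : Theta -> probability Y R)
    (f : X -> Y) (e : R) :
  measurable_fun setT f ->
  (forall theta A, measurable A ->
     `|E theta (f @^-1` A) - F theta A| <= e%:E) ->
  deficiency E F <= (2 * e)%:E.
Proof.
move=> mf EF.
pose K (mu : {charge set X -> \bar R}) : {charge set Y -> \bar R} :=
  measure_function_pushforward__canonical__charge_Charge mu mf.
have mfA A : measurable A -> measurable (f @^-1` A).
  by move=> mA; rewrite -[X in measurable X]setTI; apply: (mf).
apply: ge_ereal_inf; eexists; first exists K.
- split.
  + by [].
  + by move=> mu _ mu0 B mB; apply: mu0; exact: mfA.
  + by [].
- by [].
apply: ge_ereal_sup => _ [theta _ <-]; apply: tv_norm_le => A mA.
rewrite [X in `|X|](_ : _ = E theta (f @^-1` A) - F theta A); last first.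
  by rewrite -[X in _ = _ + X]mulN1e.
exact: EF.
Qed.

End deficiency_bounds.

(** * Product probabilities *)

Section product_probability.
Local Open Scope ereal_scope.

Lemma measurable_map_tuple dX dY (X : measurableType dX)
    (Y : measurableType dY) n (f : X -> Y) : measurable_fun setT f ->
  measurable_fun setT (map_tuple f : n.-tuple X -> n.-tuple Y).
Proof.
move=> mf; apply/measurable_fun_tnthP => i.
rewrite (_ : _ \o _ = f \o (@tnth _ X ^~ i)).
  by apply: measurableT_comp => //; exact: measurable_tnth.
by apply/funext => x /=; rewrite tnth_map.
Qed.

(** Sections commute with coordinatewise images, so Fubini gives the step from
    n to n.+1. *)
Lemma prod_prob_distribution dX dY (X : measurableType dX)
    (Y : measurableType dY) (R : realType) (P : probability X R)
    (f : {mfun X >-> Y}) n (A : set (n.-tuple Y)) : measurable A ->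
  prod_prob (distribution P f) n A = prod_prob P n (map_tuple f @^-1` A).
Proof.
elim: n A => [|n IH] A mA.
  rewrite /= !diracE; congr ((_ : bool)%:R%:E).
  have f0 : map_tuple f [tuple] = [tuple] by apply: val_inj.
  by apply/idP/idP => /set_mem A0; apply: mem_set; move: A0; rewrite /= f0.
have mB : measurable (@tuple_cons _ Y n @^-1` A).
  by rewrite -[X in measurable X]setTI; exact: measurable_tuple_cons.
have step y : prod_prob (distribution P f) n
      (xsection (@tuple_cons _ Y n @^-1` A) y) =
    prod_prob P n (map_tuple f @^-1` xsection (@tuple_cons _ Y n @^-1` A) y).
  by rewrite IH//; exact: measurable_xsection.
transitivity (\int[distribution P f]_y prod_prob (distribution P f) n
    (xsection (@tuple_cons _ Y n @^-1` A) y)); first by [].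
rewrite ge0_integral_distribution//=; last exact: measurable_fun_xsection.
apply: eq_integral => x _; rewrite step; congr (prod_prob P n _).
apply/seteqP; split => t /=; rewrite /xsection /= !in_setE /=;
  suff -> : map_tuple f (tuple_cons (x, t)) = tuple_cons (f x, map_tuple f t)
    by []; exact: val_inj.
Qed.

Let measurable_tnth_preimage d (X : measurableType d) n (A : set X)
    (i : 'I_n) :
  measurable A -> measurable [set x : n.-tuple X | A (tnth x i)].
Proof.
by move=> mA; rewrite -[X in measurable X]setTI; exact: measurable_tnth.
Qed.

Lemma exists_tnthE (X : Type) n (A : set X) :
  [set x : n.-tuple X | exists i, A (tnth x i)] =
  \big[setU/set0]_(i < n) [set x | A (tnth x i)].
Proof.
rewrite -bigcup_seq; apply/seteqP; split => x /= [i].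
  by move=> Ai; exists i => //=; rewrite mem_index_enum.
by move=> _ Ai; exists i.
Qed.

Lemma measurable_exists_tnth d (X : measurableType d) n (A : set X) :
  measurable A -> measurable [set x : n.-tuple X | exists i, A (tnth x i)].
Proof.
move=> mA; rewrite exists_tnthE; apply: bigsetU_measurable => i _.
exact: measurable_tnth_preimage.
Qed.

(** Union bound: every coordinate has law P. *)
Lemma prod_prob_exists_le d (X : measurableType d) (R : realType)
    (P : probability X R) n (A : set X) : measurable A ->
  prod_prob P n [set x | exists i, A (tnth x i)] <= n%:R%:E * P A.
Proof.
move=> mA; have mAi (i : 'I_n) := measurable_tnth_preimage i mA.
have PAi (i : 'I_n) : prod_prob P n [set x | A (tnth x i)] = P A.
  pose B j := if j == i then A else setT.
  rewrite (_ : mkset _ = [set x | forall j, B j (tnth x j)]); last first.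
    apply/seteqP; split => x /=; rewrite /B.
      by move=> Ai j; case: eqP => // ->.
    by move=> /(_ i); rewrite eqxx.
  rewrite prod_probE; last by move=> j; rewrite /B; case: ifP.
  rewrite (bigD1 i)//= big1 ?mule1 /B ?eqxx// => j /negbTE ->.
  exact: probability_setT.
rewrite exists_tnthE.
have [_] : measurable (\big[setU/set0]_(i < n) [set x | A (tnth x i)]) /\
    prod_prob P n (\big[setU/set0]_(i < n) [set x | A (tnth x i)])
      <= \sum_(i < n) P A.
  elim/big_rec2: _ => [|i v S _ [mS Sv]]; first by rewrite measure0.
  split; first exact: measurableU.
  apply: le_trans (measureU2 _ _ _) _ => //.
  by apply: leeD; rewrite // -(PAi i).
by rewrite sumr_const card_ord mule_natl.
Qed.

(** Variance of a sum of i.i.d. terms: the hypothesis says that h is centred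
    with variance s.  Quantifying over the shift c makes the statement
    inductive, the first coordinate being absorbed into c, and keeps every
    integrand nonnegative, so that Tonelli's theorem applies. *)
Lemma integral_prod_prob_sqr_sum d (X : measurableType d) (R : realType)
    (P : probability X R) (h : X -> R) (s : R) n c :
  measurable_fun setT h ->
  (forall c, \int[P]_x ((c + h x) ^+ 2)%:E = (c ^+ 2 + s)%:E) ->
  \int[prod_prob P n]_x ((c + \sum_(i < n) h (tnth x i)) ^+ 2)%:E
    = (c ^+ 2 + n%:R * s)%:E.
Proof.
move=> mh Ph.
have s0 : (0 <= s)%R.
  rewrite -lee_fin (_ : s = 0 ^+ 2 + s)%R -?Ph; last by rewrite expr0n add0r.
  apply: integral_ge0 => x _.
  by rewrite lee_fin sqr_ge0.
have msum m : measurable_fun setT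
    (fun x : m.-tuple X => (\sum_(i < m) h (tnth x i))%R).
  apply: measurable_sum => i.
  by apply: measurableT_comp => //; exact: measurable_tnth.
elim: n c => [|n IH] c.
  rewrite /= integral_dirac//.
    by rewrite diracT mul1e big_ord0 addr0 mul0r addr0.
  apply/measurable_EFinP/measurable_funX/measurable_funD => //; exact: (msum 0%N).
have split_sum x y : (c + \sum_(i < n.+1) h (tnth (tuple_cons (x, y)) i) =
    (c + h x) + \sum_(i < n) h (tnth y i))%R.
  rewrite big_ord_recl addrA; congr (_ + _)%R.
  by apply: eq_bigr => i _; rewrite tnthS.
have mS m (a : R) : measurable_fun setT
    (fun x : m.-tuple X => ((a + \sum_(i < m) h (tnth x i)) ^+ 2)%:E).
  apply/measurable_EFinP/measurable_funX/measurable_funD => //; exact: msum.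
rewrite /= ge0_integral_distribution//=; last 2 first.
- exact: mS.
- by move=> y; rewrite lee_fin sqr_ge0.
rewrite fubini_tonelli1//=; last 2 first.
- by apply: measurableT_comp (mS _ _) (@measurable_tuple_cons _ X n).
- by move=> y; rewrite lee_fin sqr_ge0.
rewrite /fubini_F.
under eq_integral do under eq_integral do rewrite split_sum.
under eq_integral do rewrite IH EFinD.
rewrite ge0_integralD//=.
- rewrite Ph integral_cst//= probability_setT mule1 -EFinD; congr EFin.
  rewrite -natr1; ring.
- by move=> x _; rewrite lee_fin sqr_ge0.
- by apply/measurable_EFinP/measurable_funX/measurable_funD.
- by move=> x _; rewrite lee_fin mulr_ge0.
Qed.

Lemma prod_prob_chebyshev d (X : measurableType d) (R : realType)
    (P : probability X R) (h : X -> R) (s : R) n t :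
  measurable_fun setT h ->
  (forall c, \int[P]_x ((c + h x) ^+ 2)%:E = (c ^+ 2 + s)%:E) -> (0 < t)%R ->
  prod_prob P n [set x | t <= `|\sum_(i < n) h (tnth x i)|]%R
    <= (n%:R * s / t ^+ 2)%:E.
Proof.
move=> mh Ph t0.
pose S (x : n.-tuple X) := (\sum_(i < n) h (tnth x i))%R.
have mS : measurable_fun setT S.
  apply: measurable_sum => i.
  by apply: measurableT_comp => //; exact: measurable_tnth.
pose S' : {mfun n.-tuple X >-> R} :=
  HB.pack S (isMeasurableFun.Build _ _ _ _ S mS).
have := @markov _ _ _ (prod_prob P n) S' (fun x => x ^+ 2)%R t t0.
have -> : 'E_(prod_prob P n)[(fun x => x ^+ 2)%R \o (fun x => `|x|)%R \o S'] =
    (n%:R * s)%:E.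
  rewrite unlock -[RHS]add0e; have := integral_prod_prob_sqr_sum n 0 mh Ph.
  rewrite expr0n add0r => <-; rewrite add0e; apply: eq_integral => x _ /=.
  by rewrite real_normK ?num_real// add0r.
move=> h1; rewrite EFinM lee_pdivlMr ?exprn_gt0// muleC; apply: h1.
- exact: measurable_funX.
- by move=> r _; exact: sqr_ge0.
- by move=> x y; rewrite !nnegrE => x0 y0 xy; rewrite ler_pXn2r.
Qed.

End product_probability.

(** * The law of one observation *)

(** Change of variables for a random variable Y whose law has density q with
    respect to mu: q agrees almost everywhere with the Radon-Nikodym derivative
    of the law. *)
Lemma ge0_integral_density dX d (X : measurableType dX) (T : measurableType d)
    (R : realType) (P : probability X R) (Y : {mfun X >-> T})
    (mu : {sigma_finite_measure set T -> \bar R}) (q : T -> R)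
    (f : T -> \bar R) :
  measurable_fun setT q ->
  (forall A, measurable A ->
     P (Y @^-1` A) = \int[mu]_(x in A) (q x)%:E)%E ->
  measurable_fun setT f -> (forall x, 0 <= f x)%E ->
  (\int[P]_x f (Y x) = \int[mu]_x (f x * (q x)%:E))%E.
Proof.
move=> mq PE mf f0; pose nu := distribution P Y.
rewrite -(@ge0_integral_distribution _ _ _ _ _ P Y f)//.
have numu : nu `<< mu.
  apply/null_content_dominatesP => A mA muA0.
  rewrite /nu/= /distribution/= /pushforward PE//.
  by apply: null_set_integral => //; apply/measurable_EFinP/measurable_funTS.
have iRN := Radon_Nikodym_SigmaFinite.f_integrable numu.
have mRN := measurable_int mu iRN.
have mq' : measurable_fun setT (EFin \o q) by exact/measurable_EFinP.
rewrite -(Radon_Nikodym_SigmaFinite.change_of_variables numu f0 measurableT mf).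
apply: ae_eq_integral => //; [exact: emeasurable_funM..|].
apply: ae_eqe_mul2l; apply: integral_ae_eq => // A _ mA.
by rewrite -Radon_Nikodym_SigmaFinite.f_integral// -PE.
Qed.

Section one_observation.
Context {R : realType}.
Implicit Types theta c delta : R.
Local Notation mu := (@lebesgue_measure R).

(** 65/2 is the sum of the coefficients on the left, and no power of x there
    exceeds x^4. *)
Let quartic_le (x : R) : 1 <= x ->
  2^-1 * x ^+ 4 + 2 * x ^+ 3 + 6 * x ^+ 2 + 12 * x + 12 <= 65 / 2 * x ^+ 4.
Proof.
move=> x1; have x0 : 0 <= x by apply: le_trans x1.
have x23 : x ^+ 2 <= x ^+ 3 by rewrite [leRHS]exprS ler_peMl// exprn_ge0.
have x34 : x ^+ 3 <= x ^+ 4 by rewrite [leRHS]exprS ler_peMl// exprn_ge0.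
have x12 : x <= x ^+ 2 by rewrite expr2 ler_peMl.
lra.
Qed.

(** The antiderivative of w^4 exp(-w) / 2 that vanishes at infinity; the second
    moment of g is minus its value at 0. *)
Let F (w : R) :=
  - (2^-1 * w ^+ 4 + 2 * w ^+ 3 + 6 * w ^+ 2 + 12 * w + 12) * expR (- w).

Let cvg_F : F x @[x --> +oo] --> (0 : R).
Proof.
apply/cvgrPdist_le => e e0; near=> x.
have x1 : 1 <= x by near: x; apply: nbhs_pinfty_ge; exact: num_real.
(* 3900 = 120 * 65/2, from the constants 5! and 65/2. *)
have xe : 3900 / e <= x by near: x; apply: nbhs_pinfty_ge; exact: num_real.
have x0 : 0 < x by apply: lt_le_trans x1.
rewrite sub0r /F mulNr opprK ger0_norm; last first.
  by rewrite mulr_ge0 ?expR_ge0// !addr_ge0// ?mulr_ge0 ?exprn_ge0// ltW.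
(* The degree 5 term of the exponential series dominates the quartic factor. *)
have h5 : x ^+ 5 / 120 <= expR x.
  by apply: le_trans (@expR_ge1Dxn R x 4 (ltW x0)); rewrite lerDr.
rewrite expRN; set E := expR x in h5 *.
have E0 : 0 < E by exact: expR_gt0.
rewrite ler_pdivrMr//.
apply: (@le_trans _ _ (e * (x ^+ 5 / 120))); last by rewrite ler_pM2l.
have xe' : 3900 <= x * e by rewrite -ler_pdivrMr.
apply: (@le_trans _ _ (65 / 2 * x ^+ 4)); last first.
  have : 3900 * x ^+ 4 <= x * e * x ^+ 4 by rewrite ler_wpM2r// exprn_ge0// ltW.
  rewrite [x ^+ 5]exprS; clear; lra.
exact: quartic_le.
Unshelve. all: end_near. Qed.

Let dF (x : R) : is_derive x 1 F (2^-1 * x ^+ 4 * expR (- x)).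
Proof.
apply: is_derive_eq.
by rewrite /GRing.scale /=; field.
Qed.

Lemma continuous_sqr_gdens (p q : R) :
  continuous (fun w : R => (p + q * w) ^+ 2 * gdens w).
Proof.
move=> w; apply: (@cvgM _ R); last exact: continuous_gdens.
have ca : {for w, continuous (fun w : R => p + q * w)}.
  apply: (@cvgD _ R^o); first exact: cvg_cst.
  by apply: (@cvgM _ R); [exact: cvg_cst|exact: cvg_id].
under eq_fun do rewrite expr2.
exact: (@cvgM _ R).
Qed.

Lemma integral_sqr_gdens : (\int[mu]_w (w ^+ 2 * gdens w)%:E = 12%:E)%E.
Proof.
rewrite -(setUv `[0, +oo[%classic) ge0_integral_setU//=; last 4 first.
- exact: measurableC.
- rewrite setUv; apply/measurable_EFinP/measurable_funM => //.
  exact: measurable_gdens.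
- by move=> x _; rewrite lee_fin mulr_ge0 ?sqr_ge0 ?gdens_ge0.
- exact/disj_setPCl.
rewrite [X in (_ + X)%E]integral0_eq ?adde0; last first.
  move=> x /= x0; rewrite /gdens ifF ?mulr0//; apply/negbTE; rewrite -leNgt.
  by move/negP: x0; rewrite in_itv/= andbT -ltNge => /ltW.
rewrite (@ge0_continuous_FTC2y _ _ F _ 0)//.
- by rewrite -EFinB /F oppr0 expR0; congr EFin; ring.
- by move=> x _; rewrite mulr_ge0 ?sqr_ge0 ?gdens_ge0.
- rewrite (_ : (fun _ => _) = (fun w : R => (0 + 1 * w) ^+ 2 * gdens w)).
    exact/continuous_subspaceT/continuous_sqr_gdens.
  by apply/funext => w; rewrite add0r mul1r.
- apply: cvg_at_right_filter; apply: differentiable_continuous.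
  by apply/derivable1_diffP; case: (dF 0).
- move=> x; rewrite in_itv/= andbT => x0.
  case: (dF x) => _ dFx; rewrite derive1E dFx /gdens x0; ring.
Qed.


Lemma integral_flip theta (h : R -> R) : continuous h -> (forall x, 0 <= h x) ->
  (\int[mu]_y (h (theta - y))%:E = \int[mu]_y (h y)%:E)%E.
Proof.
move=> ch h0; under eq_integral do rewrite -opprB.
rewrite (@integral_shift R theta (h \o -%R)) //=.
  by rewrite integral_oppr//; exact: continuous_measurable_fun.
move=> x; apply: continuous_comp; last exact: ch.
by apply: (@continuousN _ R^o); exact: cvg_id.
Qed.

Let measurable_qdens theta : measurable_fun setT
  (fun y : R => 2^-1 * gdens (y - theta) + 2^-1 * gdens (theta - y) : R).
Proof.
by apply: measurable_funD; apply: measurable_funM => //;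
  apply: measurableT_comp (measurable_gdens) _; exact: measurable_funB.
Qed.

(** The shifts bring both halves of the density to g, and the cross terms
    of (c + w)^2 and (c - w)^2 cancel. *)
Let integral_sqr_qdens theta c :
  (\int[mu]_y (((c + (y - theta)) ^+ 2)%:E *
    (2^-1 * gdens (y - theta) + 2^-1 * gdens (theta - y))%:E) =
   (c ^+ 2 + 12)%:E)%E.
Proof.
have h0 (p q w : R) : 0 <= (p + q * w) ^+ 2 * gdens w.
  by rewrite mulr_ge0 ?sqr_ge0 ?gdens_ge0.
have mh p q : measurable_fun setT (fun w : R => ((p + q * w) ^+ 2 * gdens w)%:E).
  by apply/measurable_EFinP; apply: continuous_measurable_fun;
    exact: continuous_sqr_gdens.
have mhs p q (s : R -> R) : measurable_fun setT s ->
    measurable_fun setT (fun w : R => ((p + q * s w) ^+ 2 * gdens (s w))%:E).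
  by move=> ms; exact: measurableT_comp (mh p q) ms.
transitivity (2^-1%:E *
    (\int[mu]_y ((c + 1 * (y - theta)) ^+ 2 * gdens (y - theta))%:E +
     \int[mu]_y ((c + (- 1) * (theta - y)) ^+ 2 * gdens (theta - y))%:E))%E.
  rewrite -ge0_integralD//; last 4 first.
  - by move=> y _; rewrite lee_fin; exact: h0.
  - by apply: mhs; exact: measurable_funB.
  - by move=> y _; rewrite lee_fin; exact: h0.
  - by apply: mhs; exact: measurable_funB.
  rewrite -ge0_integralZl//; last 2 first.
  - by apply: emeasurable_funD; apply: mhs; exact: measurable_funB.
  - by move=> y _; rewrite adde_ge0// lee_fin; exact: h0.
  by apply: eq_integral => y _; rewrite -EFinM -EFinD -EFinM; congr EFin; ring.
rewrite (integral_shift theta (@continuous_sqr_gdens c 1) (h0 c 1)).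
rewrite (integral_flip theta (@continuous_sqr_gdens c (- 1)) (h0 c (- 1))).
rewrite -ge0_integralD//; last 4 first.
- by move=> y _; rewrite lee_fin; exact: h0.
- exact: mh.
- by move=> y _; rewrite lee_fin; exact: h0.
- exact: mh.
transitivity (2^-1%:E *
    (\int[mu]_w (2%:E * ((c ^+ 2)%:E * (gdens w)%:E + (w ^+ 2 * gdens w)%:E))))%E.
  congr (_ * _)%E; apply: eq_integral => w _.
  by rewrite -EFinM -!EFinD; congr EFin; ring.
have mg : measurable_fun setT (fun w : R => (gdens w)%:E).
  by apply/measurable_EFinP; exact: measurable_gdens.
have mg2 : measurable_fun setT (fun w : R => (w ^+ 2 * gdens w)%:E).
  by apply/measurable_EFinP/measurable_funM => //; exact: measurable_gdens.
have c0 : (0 <= (c ^+ 2)%:E)%E by rewrite lee_fin sqr_ge0.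
have g0 (w : R) : (0 <= (gdens w)%:E)%E by rewrite lee_fin gdens_ge0.
have g20 (w : R) : (0 <= (w ^+ 2 * gdens w)%:E)%E.
  by rewrite lee_fin mulr_ge0 ?sqr_ge0 ?gdens_ge0.
have mcg : measurable_fun setT (fun w : R => (c ^+ 2)%:E * (gdens w)%:E)%E.
  exact: measurable_funeM.
have cg0 (w : R) : (0 <= (c ^+ 2)%:E * (gdens w)%:E)%E by rewrite mule_ge0.
rewrite ge0_integralZl//; last 2 first.
- exact: emeasurable_funD.
- by move=> w _; rewrite adde_ge0.
rewrite ge0_integralD// ge0_integralZl// integral_gdens integral_sqr_gdens.
by rewrite mule1 -EFinD -!EFinM; congr EFin; field.
Qed.

(** Under P_theta, y - theta is centred with variance 12. *)
Lemma Pmeas_sqr theta c :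
  (\int[Pmeas theta]_yz ((c + (yz.1 - theta)) ^+ 2)%:E = (c ^+ 2 + 12)%:E)%E.
Proof.
pose phi (y : R) : \bar R := ((c + (y - theta)) ^+ 2)%:E.
have mphi : measurable_fun setT phi.
  by apply/measurable_EFinP/measurable_funX/measurable_funD => //;
    exact: measurable_funB.
have phi0 y : (0 <= phi y)%E by rewrite lee_fin sqr_ge0.
(* Lebesgue measure lives on measurableTypeR R, whose display is not that of R. *)
pose Y : {mfun (R * bool)%type >-> measurableTypeR R} :=
  HB.pack (fst : R * bool -> measurableTypeR R)
    (isMeasurableFun.Build _ _ (R * bool)%type (measurableTypeR R)
       fst measurable_fst).
rewrite (@ge0_integral_density _ _ _ _ _ (Pmeas theta) Y mu
  (fun y => 2^-1 * gdens (y - theta) + 2^-1 * gdens (theta - y)) phi)//;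
  last 2 first.
- exact: measurable_qdens.
- by move=> A mA; exact: QmeasE.
exact: integral_sqr_qdens.
Qed.

Lemma gdens_le w : gdens w <= 2^-1 * w ^+ 2 :> R.
Proof.
rewrite /gdens; case: ifPn => [w0|_]; last by rewrite mulr_ge0 ?sqr_ge0.
apply: ler_piMr; first by rewrite mulr_ge0 ?sqr_ge0.
by rewrite -[leRHS]expR0 ler_expR oppr_le0 ltW.
Qed.

Lemma near_itvE theta delta :
  [set y : R | `|y - theta| <= delta] = `[theta - delta, theta + delta]%classic.
Proof. by apply/seteqP; split => y /=; rewrite in_itv/= ler_distl. Qed.

(** The density is at most delta^2 / 2 on an interval of length 2 delta. *)
Lemma Pmeas_near theta delta : 0 <= delta ->
  (Pmeas theta ([set y | (`|y - theta| <= delta)%R] `*` setT)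
    <= (delta ^+ 3)%:E)%E.
Proof.
move=> d0; rewrite near_itvE Pmeas_setX//.
apply: (@le_trans _ _ (\int[mu]_(y in `[(theta - delta)%R, (theta + delta)%R])
   (delta ^+ 2 / 2)%:E)%E).
  apply: ge0_le_integral => //=.
  - by move=> y _; rewrite lee_fin addr_ge0// mulr_ge0// gdens_ge0.
  - apply/measurable_EFinP/measurable_funTS; exact: measurable_qdens.
  - move=> y; rewrite in_itv/= => /andP[y1 y2]; rewrite lee_fin.
    have := gdens_le (y - theta); have := gdens_le (theta - y).
    have -> : (theta - y) ^+ 2 = (y - theta) ^+ 2 by ring.
    have : (y - theta) ^+ 2 <= delta ^+ 2.
      by rewrite -[leLHS]real_normK ?num_real// ler_pXn2r ?nnegrE// ler_distl y1 y2.
    lra.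
rewrite integral_cst//= lebesgue_measure_itv/=; case: ifPn => _.
  by rewrite -EFinD -EFinM lee_fin le_eqVlt; apply/orP; left; apply/eqP; field.
by rewrite mule0 lee_fin exprn_ge0.
Qed.

(** The density f_theta is 0 wherever z is not the sign of y - theta. *)
Lemma Pmeas_wrong_sign theta :
  Pmeas theta [set yz | yz.2 != (theta < yz.1)] = 0%E.
Proof.
rewrite /Pmeas integral0_eq// => -[y [|]] /=; rewrite /fdens/= /gdens.
  by rewrite subr_gt0; case: ltP.
by rewrite subr_gt0; case: ltP => //= ty; rewrite ltNge (ltW ty).
Qed.

End one_observation.

(** * Recovering the signs *)

(** Each of A and B is contained in the union of the other one with N. *)
Lemma probability_agree_le d (X : measurableType d) (R : realType)
    (P : probability X R) (A B N : set X) :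
  measurable A -> measurable B -> measurable N ->
  (forall x, ~ N x -> A x <-> B x) -> (`|P A - P B| <= P N)%E.
Proof.
move=> mA mB mN AB.
have leU (C D : set X) : measurable C -> measurable D ->
    C `<=` D `|` N -> (P C <= P D + P N)%E.
  move=> mC mD CDN; apply: le_trans (measureU2 _ mD mN).
  by apply: le_measure => //; rewrite inE//; exact: measurableU.
have hA : (P A <= P B + P N)%E.
  apply: leU => // x Ax; have [Nx|Nx] := pselect (N x); first by right.
  by left; apply/(AB x Nx).
have hB : (P B <= P A + P N)%E.
  apply: leU => // x Ax; have [Nx|Nx] := pselect (N x); first by right.
  by left; apply/(AB x Nx).
move: hA hB; rewrite -(fineK (fin_num_measure P _ mA)).
rewrite -(fineK (fin_num_measure P _ mB)) -(fineK (fin_num_measure P _ mN)).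
by rewrite -!EFinD !lee_fin => hA hB; rewrite ler_distl; apply/andP; split; lra.
Qed.

Section reconstruction.
Context {R : realType}.

Definition mean n (y : n.-tuple R) : R := n%:R^-1 * \sum_(i < n) tnth y i.

(** The sample mean plays the role of the unknown theta. *)
Definition relabel n (y : n.-tuple R) : n.-tuple (R * bool) :=
  [tuple (tnth y i, mean y < tnth y i) | i < n].

Lemma measurable_mean n : measurable_fun setT (@mean n).
Proof.
apply: measurable_funM => //; apply: measurable_sum => i.
exact: measurable_tnth.
Qed.

Lemma measurable_relabel n : measurable_fun setT (@relabel n).
Proof.
apply/measurable_fun_tnthP => i.
rewrite (_ : _ \o _ = fun y : n.-tuple R => (tnth y i, mean y < tnth y i)).
  apply/measurable_fun_pairP; split; first exact: measurable_tnth.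
  by apply: measurable_fun_ltr; [exact: measurable_mean|exact: measurable_tnth].
by apply/funext => y; rewrite /= tnth_mktuple.
Qed.

Lemma Qn_map n theta (A : set (n.-tuple R)) : measurable A ->
  Qn n theta A = Pn n theta (map_tuple fst @^-1` A).
Proof. exact: prod_prob_distribution. Qed.

(** The pairs whose sign may be read off wrongly from an estimate of theta that
    is within delta of it. *)
Definition mislabelled theta delta : set (R * bool) :=
  ([set y | `|y - theta| <= delta] `*` setT) `|`
  [set yz | yz.2 != (theta < yz.1)].

Lemma measurable_near theta delta :
  measurable ([set y : R | `|y - theta| <= delta] `*` [set: bool]).
Proof.
by apply: measurableX => //; rewrite near_itvE; exact: measurable_itv.
Qed.

Lemma measurable_wrong_sign theta :
  measurable [set yz : R * bool | yz.2 != (theta < yz.1)].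
Proof.
pose b (yz : R * bool) := if yz.2 then ~~ (theta < yz.1) else theta < yz.1.
have mlt : measurable_fun setT (fun yz : R * bool => theta < yz.1).
  exact: measurable_fun_ltr.
have mb : measurable_fun setT b.
  by apply: measurable_fun_ifT => //; exact: measurable_neg.
rewrite (_ : mkset _ = b @^-1` [set true]).
  by rewrite -[X in measurable X]setTI; exact: mb.
by apply/seteqP; split => -[y []]; rewrite /b/=; case: ltP.
Qed.

Lemma measurable_mislabelled theta delta : measurable (mislabelled theta delta).
Proof.
by apply: measurableU; [exact: measurable_near|exact: measurable_wrong_sign].
Qed.

Lemma Pmeas_mislabelled theta delta : 0 <= delta ->
  (Pmeas theta (mislabelled theta delta) <= (delta ^+ 3)%:E)%E.
Proof.
move=> d0; apply: le_trans (measureU2 _ _ _) _.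
- exact: measurable_near.
- exact: measurable_wrong_sign.
rewrite -[leRHS]adde0; apply: leeD; first exact: Pmeas_near.
by rewrite -[leRHS](Pmeas_wrong_sign theta).
Qed.

(** Every y_i is more than delta away from theta and the mean is less than
    delta away, so both are on the same side of y_i. *)
Lemma relabel_map_fst n theta delta (x : n.-tuple (R * bool)) : (0 < n)%N ->
  (forall i, ~ mislabelled theta delta (tnth x i)) ->
  `|\sum_(i < n) ((tnth x i).1 - theta)| < n%:R * delta ->
  relabel (map_tuple fst x) = x.
Proof.
move=> n0 ok xd; apply: eq_from_tnth => i.
have nR : 0 < n%:R :> R by rewrite ltr0n.
have {xd} md : `|mean (map_tuple fst x) - theta| < delta.
  rewrite -(ltr_pM2l nR) -[X in X * `|_|]gtr0_norm// -normrM /mean.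
  rewrite mulrBr mulrA divff ?gt_eqF// mul1r.
  rewrite (_ : _ - _ = \sum_(i < n) ((tnth x i).1 - theta)) ?(gtr0_norm nR)//.
  rewrite sumrB sumr_const card_ord mulr_natl; congr (_ - _).
  by apply: eq_bigr => j _; rewrite tnth_map.
rewrite tnth_mktuple tnth_map; case: (tnth x i) (ok i) => y z /=.
move=> /not_orP[/= yd /negP/negPn/eqP /= ->]; congr (_, _).
have {}yd : delta < `|y - theta| by rewrite ltNge; apply/negP => ?; apply: yd.
move: md yd; set m := mean _; rewrite ltr_norml ltr_normr => /andP[m1 m2].
by case/orP => ?; apply/idP/idP => ?; lra.
Qed.

(** The relabelled sample and the original one agree unless an observation is
    mislabelled (union bound) or the mean is far from theta (Chebyshev). *)
Lemma Pn_relabel_le n theta delta A : (0 < n)%N -> 0 < delta -> measurable A ->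
  (`|Qn n theta (@relabel n @^-1` A) - Pn n theta A|
    <= (n%:R * delta ^+ 3 + 12 / (n%:R * delta ^+ 2))%:E)%E.
Proof.
move=> n0 d0 mA.
pose N := [set x : n.-tuple (R * bool) |
    exists i, mislabelled theta delta (tnth x i)]
  `|` [set x | n%:R * delta <= `|\sum_(i < n) ((tnth x i).1 - theta)|].
have nR : 0 < n%:R :> R by rewrite ltr0n.
have mfst : measurable_fun setT (fun yz : R * bool => yz.1 - theta).
  exact: measurable_funB.
have mT B : measurable B ->
    measurable (map_tuple fst @^-1` B : set (n.-tuple (R * bool))).
  by move=> mB; rewrite -[X in measurable X]setTI; exact: measurable_map_tuple.
have mrelA : measurable (@relabel n @^-1` A).
  by rewrite -[X in measurable X]setTI; exact: measurable_relabel.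
have mN1 : measurable [set x : n.-tuple (R * bool) |
    exists i, mislabelled theta delta (tnth x i)].
  exact: measurable_exists_tnth (measurable_mislabelled _ _).
have mN2 : measurable [set x : n.-tuple (R * bool) |
    n%:R * delta <= `|\sum_(i < n) ((tnth x i).1 - theta)|].
  rewrite -[X in measurable X]setTI; apply: measurable_fun_le => //.
  apply: measurableT_comp => //; apply: measurable_sum => i.
  exact: measurableT_comp mfst (measurable_tnth _).
rewrite Qn_map//.
apply: (@le_trans _ _ (Pn n theta N)).
  apply: probability_agree_le => //; [exact: mT|exact: measurableU|].
  move=> x /not_orP[/= ok /negP]; rewrite -ltNge => xd.
  by rewrite (relabel_map_fst n0 _ xd)// => i ?; apply: ok; exists i.
apply: le_trans (measureU2 (Pn n theta) mN1 mN2) _; rewrite EFinD; apply: leeD.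
  apply: le_trans (prod_prob_exists_le _ _ (measurable_mislabelled _ _)) _.
  rewrite EFinM lee_wpmul2l// ?lee_fin//.
  by apply: Pmeas_mislabelled; exact: ltW.
have nd : 0 < n%:R * delta by rewrite mulr_gt0.
have := @prod_prob_chebyshev _ _ _ _ _ _ n _ mfst (Pmeas_sqr theta) nd.
move/le_trans; apply.
rewrite lee_fin le_eqVlt; apply/orP; left; apply/eqP; field.
by rewrite !gt_eqF.
Qed.

Lemma LeCam_distance_le n delta : (0 < n)%N -> 0 < delta ->
  (LeCam_distance (@Pn R n) (@Qn R n)
    <= (2 * (n%:R * delta ^+ 3 + 12 / (n%:R * delta ^+ 2)))%:E)%E.
Proof.
move=> n0 d0; rewrite /LeCam_distance ge_max; apply/andP; split.
- apply: (@le_trans _ _ (2 * 0)%:E); last first.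
    by rewrite lee_fin mulr0 mulr_ge0// addr_ge0
      ?divr_ge0 ?mulr_ge0 ?exprn_ge0 ?(ltW d0).
  apply: (@deficiency_le_map _ _ _ _ _ _ _ _ (map_tuple fst)).
    exact: measurable_map_tuple.
  move=> theta A mA; rewrite Qn_map// subee ?abse0//.
  apply: fin_num_measure; rewrite -[X in measurable X]setTI.
  by apply: measurable_map_tuple.
- apply: (deficiency_le_map (@measurable_relabel n)) => theta A mA.
  exact: Pn_relabel_le.
Qed.

End reconstruction.

Theorem mainTheorem2 (R : realType) :
  LeCam_distance (@Pn R n) (@Qn R n) @[n --> \oo] --> (0%R)%:E.
Proof.
pose t n : R := n%:R `^ 5^-1.
(* With delta = t n ^- 2 and n = t n ^+ 5, the two terms of the bound
   are 1 / t n and 12 / t n. *)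
pose bound n : R := 26 * (t n)^-1.
have t5 n : t n ^+ 5 = n%:R.
  by rewrite -powR_mulrn ?powR_ge0// -powRrM mulVf// powRr1.
apply: (@squeeze_cvge _ _ _ _ (cst 0%E) _ (fun n => (bound n)%:E)).
- near=> n; apply/andP; split.
    by rewrite /LeCam_distance le_max (deficiency_ge0 0).
  have n0 : (0 < n)%N by near: n; exact: nbhs_infty_gt.
  have t0 : 0 < t n by rewrite powR_gt0// ltr0n.
  have d0 : 0 < (t n) ^- 2 by rewrite invr_gt0 exprn_gt0.
  apply: le_trans (LeCam_distance_le n0 d0) _.
  rewrite lee_fin -(t5 n) /bound le_eqVlt; apply/orP; left; apply/eqP; field.
  by rewrite gt_eqF.
- exact: cvg_cst.
- apply/cvg_EFin; first by near=> n.
  apply/cvgrPdist_le => e e0; near=> n.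
  have n0 : (0 < n)%N by near: n; exact: nbhs_infty_gt.
  have t0 : 0 < t n by rewrite powR_gt0// ltr0n.
  rewrite sub0r normrN /= /bound gtr0_norm ?divr_gt0//.
  rewrite ler_pdivrMr// mulrC -ler_pdivrMr//.
  have e26 : 0 <= 26 / e by rewrite divr_ge0// ltW.
  rewrite -(@ler_pXn2r _ 5) ?nnegrE// ?(ltW t0)// t5.
  by near: n; exact: nbhs_infty_ger.
Unshelve. all: end_near. Qed.
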